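(* With the setup in the context, fix $X\subseteq E\setminus B$ and for $0\le\mu\le n$ let $E_\mu=\min_{Y\subseteq E,\,|Y|=\mu}H(\mathbf{m}\mid\mathbf{t},\mathbf{M})$ and $\Delta_\mu=n-k-E_\mu$. For $0\le j\le n-|X|-k$ let $\sigma_j=\min\{|Y|: Y\subseteq E,\ \rho_X(Y)=j\}$, and set $\sigma_{n-|X|-k+1}=\infty$. Then for $0\le j\le n-|X|-k$, $\Delta_\mu=|X|+j\iff\sigma_j\le\mu<\sigma_{j+1}.$
   Context: An almost affine code over a finite alphabet $A$ of length $n$ and dimension $k$ is a subset $C\subseteq A^n$ with $|C|=|A|^k$ such that for every $X\subseteq E=\{1,\dots,n\}$, $\log_{|A|}|C_X|$ is a nonnegative integer ($C_X$ = projection onto coordinates $X$); its associated matroid $M_C$ has rank function $r(X)=\log_{|A|}|C_X|$. Setup: $C$ is an almost affine code of length $n$ and dimension $k$ over $A$ with matroid rank function $r$; $B\subseteq E$ is a basis of $M_C$; $\varphi:A\times A\to A$ is such that for every $y\in A$ both $\varphi(y,\cdot)$ and $\varphi(\cdot,y)$ are bijections. For $\mathbf{m}\in A^{E\setminus B}$, $\Phi_{\mathbf{m}}(\mathbf{w})_i=\mathbf{w}_i$ for $i\in B$ and $=\varphi(\mathbf{w}_i,\mathbf{m}_i)$ for $i\in E\setminus B$, and $C_{\mathbf{m}}=\Phi_{\mathbf{m}}(C)$. For $X\subseteq E\setminus B$, $\mathbf{M}\in A^X$, $D_{X,\mathbf{M}}=\bigcup_{\mathbf{m}_X=\mathbf{M}}C_{\mathbf{m}}$,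 with matroid rank function $r_D(Y)=|Y\setminus(B\cup X)|+r(Y\cap(B\cup X))$, and $\rho_X(Y)=r_D(Y)-r(Y)$ (a demi-matroid rank function of rank $n-|X|-k$). The random model: $\mathbf{m}\in A^{E\setminus B}$ uniform, then $\mathbf{w}\in C_{\mathbf{m}}$ uniform; $\mathbf{M}=\mathbf{m}_X$, $\mathbf{t}=\mathbf{w}_Y$; $H(\mathbf{m}\mid\mathbf{t},\mathbf{M})$ is the conditional entropy with logarithms to base $|A|$ (convention $0\log\frac10=0$). *)

(* Defs.v *)
From Stdlib Require Import Reals.
From mathcomp Require Import all_boot.
Set Implicit Arguments. Unset Strict Implicit. Unset Printing Implicit Defensive.

(* Words of length n over A are finite functions 'I_n -> A; E = 'I_n. *)

(* Projection onto the coordinates X, encoded as a function that is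
   [None] outside X (so distinct projections <-> distinct elements of A^X). *)
Definition proj (T : Type) (n : nat) (X : {set 'I_n}) (w : {ffun 'I_n -> T})
  : {ffun 'I_n -> option T} :=
  [ffun i => if i \in X then Some (w i) else None].

Definition projC (A : finType) (n : nat) (C : {set {ffun 'I_n -> A}})
  (X : {set 'I_n}) : {set {ffun 'I_n -> option A}} :=
  [set proj X w | w in C].

Definition almost_affine (A : finType) (n k : nat) (C : {set {ffun 'I_n -> A}}) : Prop :=
  #|C| = #|A| ^ k /\ forall X : {set 'I_n}, exists r : nat, #|projC C X| = #|A| ^ r.

(* rank function r(X) = log_|A| |C_X| of the matroid M_C (exact for almost affine codes). *)
Definition rk (A : finType) (n : nat) (C : {set {ffun 'I_n -> A}}) (X : {set 'I_n}) : nat :=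
  trunc_log #|A| #|projC C X|.

Definition is_basis (A : finType) (n : nat) (C : {set {ffun 'I_n -> A}}) (B : {set 'I_n}) : Prop :=
  rk C B = #|B| /\ rk C B = rk C [set: 'I_n].

(* Messages m in A^(E\B), encoded as functions 'I_n -> option A that are
   [None] exactly on B. *)
Definition msgs (A : finType) (n : nat) (B : {set 'I_n}) : {set {ffun 'I_n -> option A}} :=
  [set m : {ffun 'I_n -> option A} | [forall i, (m i == None) == (i \in B)]].

Definition Phi (A : finType) (n : nat) (phi : A -> A -> A) (m : {ffun 'I_n -> option A})
  (w : {ffun 'I_n -> A}) : {ffun 'I_n -> A} :=
  [ffun i => match m i with Some a => phi (w i) a | None => w i end].

Definition Cm (A : finType) (n : nat) (C : {set {ffun 'I_n -> A}}) (phi : A -> A -> A)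
  (m : {ffun 'I_n -> option A}) : {set {ffun 'I_n -> A}} :=
  [set Phi phi m w | w in C].

Definition Omega (A : finType) (n : nat) : finType :=
  ({ffun 'I_n -> option A} * {ffun 'I_n -> A})%type.

(* Random model: m uniform on A^(E\B), then w uniform on C_m. *)
Definition Pmodel (A : finType) (n : nat) (C : {set {ffun 'I_n -> A}}) (B : {set 'I_n})
  (phi : A -> A -> A) (om : Omega A n) : R :=
  if (om.1 \in msgs A B) && (om.2 \in Cm C phi om.1)
  then Rinv (Rmult (INR #|msgs A B|) (INR #|Cm C phi om.1|))
  else R0.

Definition Pr (A : finType) (n : nat) (C : {set {ffun 'I_n -> A}}) (B : {set 'I_n})
  (phi : A -> A -> A) (T : finType) (f : Omega A n -> T) (v : T) : R :=
  \big[Rplus/R0]_(om : Omega A n | f om == v) Pmodel C B phi om.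

Definition logA (A : finType) (x : R) : R := Rdiv (ln x) (ln (INR #|A|)).

(* Conditional entropy H(f | g) = sum_{a,b} P(a,b) log_|A| (P(b) / P(a,b)),
   with the convention 0 log (1/0) = 0. *)
Definition condH (A : finType) (n : nat) (C : {set {ffun 'I_n -> A}}) (B : {set 'I_n})
  (phi : A -> A -> A) (T1 T2 : finType) (f : Omega A n -> T1) (g : Omega A n -> T2) : R :=
  \big[Rplus/R0]_(a : T1) \big[Rplus/R0]_(b : T2)
    (let pab := Pr C B phi (fun om => (f om, g om)) (a, b) in
     let pb := Pr C B phi g b in
     if Req_EM_T pab R0 then R0 else Rmult pab (logA A (Rdiv pb pab))).

(* H(m | t, M) with t = w_Y and M = m_X. *)
Definition Hm (A : finType) (n : nat) (C : {set {ffun 'I_n -> A}}) (B : {set 'I_n})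
  (phi : A -> A -> A) (X Y : {set 'I_n}) : R :=
  condH C B phi (fun om : Omega A n => om.1)
        (fun om : Omega A n => (proj Y om.2, proj X om.1)).

(* E_mu = min_{|Y| = mu} H(m | t, M)  (for mu <= n; the initial value is the
   set {0,...,mu-1}, which has size mu, so this is a genuine minimum). *)
Definition Emin (A : finType) (n : nat) (C : {set {ffun 'I_n -> A}}) (B : {set 'I_n})
  (phi : A -> A -> A) (X : {set 'I_n}) (mu : nat) : R :=
  \big[Rmin/Hm C B phi X [set i : 'I_n | i < mu]]_(Y : {set 'I_n} | #|Y| == mu)
     Hm C B phi X Y.

Definition Delta_mu (A : finType) (n k : nat) (C : {set {ffun 'I_n -> A}}) (B : {set 'I_n})
  (phi : A -> A -> A) (X : {set 'I_n}) (mu : nat) : R :=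
  Rminus (Rminus (INR n) (INR k)) (Emin C B phi X mu).

Definition rD (A : finType) (n : nat) (C : {set {ffun 'I_n -> A}}) (B X Y : {set 'I_n}) : nat :=
  #|Y :\: (B :|: X)| + rk C (Y :&: (B :|: X)).

(* rho_X(Y) = r_D(Y) - r(Y)  (always >= 0, so nat subtraction is exact) *)
Definition rho (A : finType) (n : nat) (C : {set {ffun 'I_n -> A}}) (B X Y : {set 'I_n}) : nat :=
  rD C B X Y - rk C Y.

(* sigma_j = min{|Y| : rho_X(Y) = j} for j <= n-|X|-k, and sigma_{n-|X|-k+1} = oo.
   Infinity is represented by n.+1, which exceeds every mu <= n. *)
Definition sigma_j (A : finType) (n k : nat) (C : {set {ffun 'I_n -> A}}) (B X : {set 'I_n})
  (j : nat) : nat :=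
  if n - #|X| - k < j then n.+1
  else \big[minn/n.+1]_(Y : {set 'I_n} | rho C B X Y == j) #|Y|.

(* Main.v *)
Require Import Defs.
From Stdlib Require Import Reals.
From mathcomp Require Import all_boot.
From mathcomp Require Import zify Rstruct.
Set Implicit Arguments. Unset Strict Implicit. Unset Printing Implicit Defensive.

(** All fibres of a projection [C -> C_Y] have the same size [q^(k - r(Y))], so
    every conditional probability occurring in [H(m | t, M)] equals
    [q^-(n - |X| - k - rho_X(Y))] and that entropy is [n - |X| - k - rho_X(Y)].
    Hence [Delta_mu = |X| + max {rho_X(Y) : |Y| = mu}].  Adding one element to [Y]
    raises [rho_X(Y)] by 0 or 1, so the maximum is at least [j] exactly when
    [sigma_j <= mu]. *)

(** * Chains of finite sets and minima over finite families *)

Lemma setU1_chain_ind (T : finType) (P : {set T} -> Prop) (Y0 Y1 : {set T}) :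
  Y0 \subset Y1 -> P Y0 ->
  (forall (Y : {set T}) i, Y0 \subset Y -> i \notin Y -> P Y -> P (i |: Y)) -> P Y1.
Proof.
move=> + P0 Pstep; have [d] := ubnP #|Y1|; elim: d Y1 => // d IH Y1 ltd sY01.
have [->//|neY] := eqVneq Y1 Y0.
have /properP[_ [i iY1 iY0]] : Y0 \proper Y1.
  by rewrite properEneq eq_sym neY.
rewrite -(setD1K iY1); apply: Pstep; rewrite ?setD11 ?subsetD1 ?sY01 //.
by apply: IH; rewrite ?subsetD1 ?sY01 //; move: ltd; rewrite (cardsD1 i) iY1.
Qed.

Lemma setU1_steps_mono (T : finType) (f : {set T} -> nat) :
  (forall (Y : {set T}) i, i \notin Y -> f Y <= f (i |: Y)) ->
  forall Y Z : {set T}, Y \subset Z -> f Y <= f Z.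
Proof.
move=> f_step Y Z sYZ; pattern Z; apply: (setU1_chain_ind sYZ) => // W i _ iW fW.
exact: leq_trans fW (f_step _ _ iW).
Qed.

(** A discrete intermediate value theorem: along a chain from [set0] to [Y], steps of at most one
    cannot jump over [j]. *)
Lemma setU1_steps_ivt (T : finType) (f : {set T} -> nat) (Y : {set T}) (j : nat) :
  (forall (Z : {set T}) i, i \notin Z -> f (i |: Z) <= (f Z).+1) ->
  f set0 <= j <= f Y -> exists2 Z : {set T}, Z \subset Y & f Z = j.
Proof.
move=> f_step /andP[f0j]; pattern Y.
apply: (setU1_chain_ind (sub0set Y)) => [fj0|Z i _ iZ IH ji].
  by exists set0 => //; apply/eqP; rewrite eqn_leq f0j.
case: (leqP j (f Z)) => [/IH[W sWZ <-]|ltj].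
  by exists W => //; apply: subset_trans sWZ (subsetUr _ _).
exists (i |: Z) => //; apply/eqP; rewrite eqn_leq ji andbT.
exact: leq_trans (f_step _ _ iZ) ltj.
Qed.

Lemma exists_superset_card (T : finType) (Y : {set T}) (m : nat) :
  #|Y| <= m <= #|T| -> exists2 Z : {set T}, Y \subset Z & #|Z| = m.
Proof.
case/andP; elim: m => [|m IH] leYm lemT.
  by exists Y => //; apply/eqP; rewrite -leqn0.
case: ltngtP leYm => // [ltYm _|<- _]; last by exists Y.
have [Z sYZ Zm] := IH ltYm (ltnW lemT).
have /set0Pn[i iZ] : ~: Z != set0.
  by rewrite -card_gt0; have := cardsC Z; lia.
exists (i |: Z); first exact: subset_trans sYZ (subsetUr _ _).
by rewrite cardsU1 -in_setC iZ Zm.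
Qed.

(** The default [x0] stays visible as a candidate because it plays two roles later: infinity in
    [sigma_j], an attained value in [Emin]. *)
Lemma bigmin_leq (T : finType) (P : pred T) (F : T -> nat) (x0 m : nat) :
  (\big[minn/x0]_(y | P y) F y <= m) = (x0 <= m) || [exists y, P y && (F y <= m)].
Proof.
apply/idP/orP => [|[x0m|/existsP[y /andP[Py Fym]]]].
- elim/big_ind: _ => [|x y IHx IHy|y Py Fym]; first by left.
    by rewrite geq_min => /orP[].
  by right; apply/existsP; exists y; rewrite Py.
- by elim/big_rec: _ => // i x Pi xm; rewrite geq_min xm orbT.
- rewrite -big_filter; have : y \in [seq z <- index_enum T | P z].
    by rewrite mem_filter Py mem_index_enum.
  elim: [seq _ <- _ | _] => // z s IH; rewrite inE big_cons geq_min.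
  by case/predU1P=> [<-|/IH->]; rewrite ?Fym ?orbT.
Qed.

(** * Rank and fibres of an almost affine code *)

Section AlmostAffine.

Variables (A : finType) (n k : nat) (C : {set {ffun 'I_n -> A}}).
Implicit Types (X Y Z : {set 'I_n}) (w v : {ffun 'I_n -> A}).

Lemma proj_eqP (T : eqType) Y (w v : {ffun 'I_n -> T}) :
  reflect {in Y, w =1 v} (proj Y w == proj Y v).
Proof.
apply: (iffP eqP) => [/ffunP pwv i iY|wv].
  by have := pwv i; rewrite !ffunE iY => -[].
by apply/ffunP=> i; rewrite !ffunE; case: ifP => // iY; rewrite wv.
Qed.

Lemma card_proj_setT : #|projC C setT| = #|C|.
Proof.
apply: card_in_imset => w v _ _ /eqP/proj_eqP wv.
by apply/ffunP=> i; apply: wv; rewrite inE.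
Qed.

Definition fiber Y w : {set {ffun 'I_n -> A}} :=
  [set v in C | proj Y v == proj Y w].

Hypothesis A_gt1 : 1 < #|A|.
Hypothesis C_aa : almost_affine k C.

Let A_gt0 : 0 < #|A|. Proof. exact: ltnW. Qed.

Lemma rkE Y : #|projC C Y| = #|A| ^ rk C Y.
Proof. by have [r Er] := C_aa.2 Y; rewrite /rk Er trunc_expnK. Qed.

Lemma rk_setT : rk C setT = k.
Proof. by rewrite /rk card_proj_setT C_aa.1 trunc_expnK. Qed.

Lemma rk_set0 : rk C set0 = 0.
Proof.
apply/eqP; rewrite -leqn0 -(leq_exp2l _ _ A_gt1) -rkE expn0.
apply: (leq_trans (subset_leq_card _) (eq_leq (cards1 (finfun (fun _ => None))))).
apply/subsetP=> _ /imsetP[w _ ->]; rewrite inE; apply/eqP/ffunP=> i.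
by rewrite !ffunE inE.
Qed.

(** Restriction of words that are already projected; it makes the code on [Y] an image of the code
    on any larger [Z]. *)
Let rest Y (p : {ffun 'I_n -> option A}) : {ffun 'I_n -> option A} :=
  [ffun i => if i \in Y then p i else None].

Let rest_proj Y Z w : Y \subset Z -> rest Y (proj Z w) = proj Y w.
Proof.
by move/subsetP=> sYZ; apply/ffunP=> i; rewrite !ffunE; case: ifP => // /sYZ ->.
Qed.

Let projC_rest Y Z : Y \subset Z -> projC C Y = rest Y @: projC C Z.
Proof.
by move=> sYZ; rewrite -imset_comp; apply: eq_imset => w /=; rewrite rest_proj.
Qed.

Lemma rk_mono Y Z : Y \subset Z -> rk C Y <= rk C Z.
Proof.
move=> sYZ; rewrite -(leq_exp2l _ _ A_gt1) -!rkE (projC_rest sYZ).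
exact: leq_imset_card.
Qed.

Lemma rk_le Y : rk C Y <= k.
Proof. by rewrite -rk_setT rk_mono ?subsetT. Qed.

(** A word on [i |: Y] is determined by its restriction to [Y] and its symbol at [i], so the
    projection grows by a factor of at most [#|A|]. *)
Lemma rk_setU1 Y i : rk C (i |: Y) <= (rk C Y).+1.
Proof.
rewrite -(leq_exp2l _ _ A_gt1) -rkE expnS mulnC -rkE.
pose g (p : {ffun 'I_n -> option A}) := (rest Y p, p i).
have g_inj : {in projC C (i |: Y) &, injective g}.
  move=> _ _ /imsetP[w _ ->] /imsetP[v _ ->] [].
  rewrite !rest_proj ?subsetUr // => /eqP/proj_eqP wv.
  rewrite !ffunE setU11 => -[wvi]; apply/eqP/proj_eqP => l.
  by case/setU1P=> [->|/wv].
have SomeI : injective (@Some A) by move=> a b [].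
rewrite -(card_in_imset g_inj) -(cardsT A) -(card_imset _ SomeI) -cardsX.
apply/subset_leq_card/subsetP=> _ /imsetP[_ /imsetP[w Cw ->] ->].
rewrite inE /= rest_proj ?subsetUr // imset_f //= ffunE setU11.
by apply: imset_f; rewrite inE.
Qed.

(** Equal ranks mean equally many projected words, that is, injectivity of the restriction from
    [i |: Y] to [Y]: the symbol at [i] is a function of those on [Y]. *)
Lemma rk_setU1_eqP Y i :
  reflect {in C &, forall w v, {in Y, w =1 v} -> w i = v i} (rk C (i |: Y) == rk C Y).
Proof.
have -> : (rk C (i |: Y) == rk C Y) = (#|projC C (i |: Y)| == #|projC C Y|).
  by rewrite !rkE eqn_exp2l.
rewrite eq_sym (projC_rest (subsetUr [set i] Y)).
apply: (iffP imset_injP) => [inj w v Cw Cv wv|det].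
  have /eqP/proj_eqP : proj (i |: Y) w = proj (i |: Y) v.
    apply: inj; rewrite ?imset_f // !rest_proj ?subsetUr //.
    by apply/eqP/proj_eqP.
  by apply; rewrite setU11.
move=> _ _ /imsetP[w Cw ->] /imsetP[v Cv ->]; rewrite !rest_proj ?subsetUr //.
move/eqP/proj_eqP=> wv; apply/eqP/proj_eqP=> l /setU1P[->|/wv //].
exact: det.
Qed.

(** If [Y] determines the symbol at [i], so does the larger [Z]. Otherwise the rank rises by one at
    [Y] and by at most one at [Z]. *)
Lemma rk_submod Y Z i :
  Y \subset Z -> rk C (i |: Z) + rk C Y <= rk C (i |: Y) + rk C Z.
Proof.
move=> /subsetP sYZ; have := rk_setU1 Z i; have := rk_mono (subsetUr [set i] Y).
case: (boolP (rk C (i |: Y) == rk C Y)) => [/rk_setU1_eqP det|]; last by lia.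
suff /eqP-> : rk C (i |: Z) == rk C Z by lia.
by apply/rk_setU1_eqP=> w v Cw Cv wv; apply: det => // l /sYZ/wv.
Qed.

(** Induction on the number of coordinates outside [Y], starting from the full coordinate set, where
    fibres are singletons. *)
Let fiber_bound Y w : w \in C -> #|fiber Y w| * #|A| ^ rk C Y <= #|A| ^ k.
Proof.
have [d] := ubnP #|~: Y|; elim: d Y w => // d IH Y w ltd Cw.
have [YT|/set0Pn[i]] := eqVneq (~: Y) set0.
  have -> : Y = setT by rewrite -(setCK Y) YT setC0.
  rewrite rk_setT; apply: leq_trans (leq_mul (_ : _ <= 1) (leqnn _)) _.
    apply: (leq_trans (subset_leq_card _) (eq_leq (cards1 w))).
    apply/subsetP=> v; rewrite !inE => /andP[_ /proj_eqP vw].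
    by apply/eqP/ffunP=> i; apply: vw; rewrite inE.
  by rewrite mul1n.
rewrite inE => iY.
have {}IH v : v \in C -> #|fiber (i |: Y) v| * #|A| ^ rk C (i |: Y) <= #|A| ^ k.
  apply: IH; move: ltd; have := cardsC Y; have := cardsC (i |: Y).
  by rewrite cardsU1 iY; lia.
(* If the rank does not rise, the symbol at [i] is constant on the fibre, which is then already a
   fibre over [i |: Y]. *)
case: (boolP (rk C (i |: Y) == rk C Y)) => [/rk_setU1_eqP det|neq].
  apply: leq_trans (IH w Cw); apply: leq_mul.
    apply/subset_leq_card/subsetP=> v; rewrite !inE => /andP[Cv /proj_eqP vw].
    rewrite Cv; apply/proj_eqP=> l /setU1P[->|/vw //].
    exact: det.
  rewrite leq_exp2l //; exact/rk_mono/subsetUr.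
(* Otherwise the fibre splits by the symbol at [i] into [#|A|] pieces, each empty or inside a fibre
   over [i |: Y], whose bound is sharper by a factor [#|A|]. *)
have rS : rk C (i |: Y) = (rk C Y).+1.
  by have := rk_setU1 Y i; have := rk_mono (subsetUr [set i] Y); lia.
rewrite rS in IH.
have -> : #|fiber Y w| = \sum_(a : A) #|[set v in fiber Y w | v i == a]|.
  rewrite -sum1_card (partition_big (fun v : {ffun 'I_n -> A} => v i) predT) //=.
  apply: eq_bigr => a _; rewrite -sum1_card.
  by apply: eq_bigl => v; rewrite !inE.
rewrite big_distrl /= -(leq_pmul2l A_gt0).
apply: (@leq_trans (#|A| * (\sum_(a : A) #|A| ^ k %/ #|A|))).
  rewrite leq_mul2l; apply/orP; right; apply: leq_sum => a _.
  have [->|/set0Pn[v]] := eqVneq [set v in fiber Y w | v i == a] set0.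
    by rewrite cards0.
  rewrite !inE => /andP[/andP[Cv /proj_eqP vw] /eqP va].
  rewrite leq_divRL // -mulnA [_ ^ _ * _]mulnC -expnS.
  apply: leq_trans (IH v Cv); rewrite leq_mul2r; apply/orP; right.
  apply/subset_leq_card/subsetP=> u; rewrite !inE.
  case/andP=> /andP[Cu /proj_eqP uw] /eqP ua; rewrite Cu.
  by apply/proj_eqP=> l /setU1P[->|lY]; rewrite ?ua ?va // uw // vw.
rewrite sum_nat_const leq_mul2l mulnC; apply/orP; right.
exact: leq_divM.
Qed.

(* Each of the [#|A| ^ rk C Y] fibres has at most [#|A| ^ (k - rk C Y)] elements
   and together they have [#|A| ^ k], so all the bounds are attained. *)
Lemma card_fiber Y w : w \in C -> #|fiber Y w| = #|A| ^ (k - rk C Y).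
Proof.
move=> Cw; pose N := #|A| ^ (k - rk C Y).
have kE : #|A| ^ k = #|projC C Y| * N by rewrite rkE -expnD subnKC // rk_le.
have bound v : v \in C -> #|fiber Y v| <= N.
  move=> Cv; have := fiber_bound Y Cv; rewrite kE rkE mulnC leq_pmul2l //.
  by rewrite expn_gt0 A_gt0.
pose F (p : {ffun 'I_n -> option A}) := #|[set v in C | proj Y v == p]|.
have FS : \sum_(p in projC C Y) F p = \sum_(p in projC C Y) N.
  rewrite sum_nat_const -kE -C_aa.1 -sum1_card.
  rewrite [RHS](partition_big_imset (@proj A n Y)); apply: eq_bigr => p _.
  by rewrite /F -sum1_card; apply: eq_bigl => v; rewrite !inE.
have /leqif_sum[_] : forall p, p \in projC C Y -> F p <= N ?= iff (F p == N).
  by move=> _ /imsetP[v Cv ->]; split=> //; exact: bound.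
rewrite FS eqxx => /esym/forall_inP/(_ (proj Y w) (imset_f _ Cw))/eqP.
by [].
Qed.

End AlmostAffine.

(** * The demi-matroid rank function [rho] and its thresholds *)

Section DemiMatroid.

Variables (A : finType) (n k : nat) (C : {set {ffun 'I_n -> A}}).
Variables (B X : {set 'I_n}).
Implicit Types (Y : {set 'I_n}).

Hypothesis A_gt1 : 1 < #|A|.
Hypothesis C_aa : almost_affine k C.

(** For [i] in [B :|: X] the first bound is submodularity of the code rank; for other [i], [rD]
    rises by exactly one and the code rank by at most one. The additive form avoids truncated
    subtraction. *)
Let rD_setU1 Y i : i \notin Y ->
  rk C (i |: Y) + rD C B X Y <= rD C B X (i |: Y) + rk C Y /\
  rD C B X (i |: Y) <= (rD C B X Y).+1.
Proof.
move=> iY; rewrite /rD; set Z := B :|: X.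
have [iZ|iZ] := boolP (i \in Z).
  have -> : (i |: Y) :\: Z = Y :\: Z.
    by apply/setP=> l; rewrite !inE; case: eqVneq => // ->; rewrite -in_setU iZ.
  have -> : (i |: Y) :&: Z = i |: (Y :&: Z).
    by apply/setP=> l; rewrite !inE; case: eqVneq => // ->; rewrite -in_setU iZ.
  have := rk_submod A_gt1 C_aa i (subsetIl Y Z).
  by have := rk_setU1 A_gt1 C_aa (Y :&: Z) i; lia.
have -> : (i |: Y) :\: Z = i |: (Y :\: Z).
  apply/setP=> l; rewrite !inE; case: eqVneq => // ->.
  by rewrite -in_setU iZ.
have -> : (i |: Y) :&: Z = Y :&: Z.
  apply/setP=> l; rewrite !inE; case: eqVneq => // ->.
  by move: iZ; rewrite inE => /negPf->; rewrite !andbF.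
rewrite cardsU1 !inE (negPf iY) andbF /=.
by have := rk_setU1 A_gt1 C_aa Y i; lia.
Qed.

Lemma rk_le_rD Y : rk C Y <= rD C B X Y.
Proof.
pattern Y; apply: (setU1_chain_ind (sub0set Y)) => [|W i _ /rD_setU1[]]; last by lia.
by rewrite (rk_set0 A_gt1 C_aa).
Qed.

Lemma rho_setU1 Y i : i \notin Y ->
  rho C B X Y <= rho C B X (i |: Y) <= (rho C B X Y).+1.
Proof.
move/rD_setU1; rewrite /rho.
have := rk_mono A_gt1 C_aa (subsetUr [set i] Y).
by have := rk_le_rD Y; have := rk_le_rD (i |: Y); lia.
Qed.

Lemma rho_set0 : rho C B X set0 = 0.
Proof. by rewrite /rho /rD set0D set0I cards0 subnn. Qed.

Hypothesis B_basis : is_basis C B.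
Hypothesis XB : X \subset ~: B.

Lemma card_basis : #|B| = k.
Proof. by have [<- ->] := B_basis; rewrite (rk_setT A_gt1 C_aa). Qed.

Lemma card_basisU : #|B :|: X| = #|X| + k.
Proof.
by rewrite cardsU (_ : B :&: X = set0) ?cards0 ?card_basis ?subn0 1?addnC //;
   apply/disjoint_setI0; rewrite disjoint_sym disjoints_subset.
Qed.

Lemma rk_basisU : rk C (B :|: X) = k.
Proof.
apply/eqP; rewrite eqn_leq (rk_le A_gt1 C_aa).
by rewrite -{1}card_basis -B_basis.1 (rk_mono A_gt1 C_aa) // subsetUl.
Qed.

(** By monotonicity only the full set matters; there both code ranks equal [k], which leaves the
    size of the complement of [B :|: X]. *)
Lemma rho_le Y : rho C B X Y <= n - #|X| - k.
Proof.
have -> : n - #|X| - k = rho C B X setT.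
  rewrite /rho /rD setTI rk_basisU (rk_setT A_gt1 C_aa) addnK setTD.
  by have := cardsC (B :|: X); rewrite card_ord card_basisU; lia.
apply: setU1_steps_mono (subsetT Y) => W i /rho_setU1.
by case/andP.
Qed.

(** A set with [rho] equal to [j] can be enlarged to size [mu] without lowering [rho]. Conversely, a
    set with [rho] at least [j] contains one with [rho] exactly [j], since [rho] starts at 0 and
    grows in unit steps. *)
Lemma sigma_leq j mu : mu <= n ->
  (sigma_j k C B X j <= mu) =
  [exists Y : {set 'I_n}, (#|Y| == mu) && (j <= rho C B X Y)].
Proof.
(* Beyond the rank of [rho] both sides are false: the threshold is [n.+1], and no set reaches
   [j]. *)
move=> le_mu; rewrite /sigma_j; case: ltnP => [ltNj|_].
  rewrite leqNgt ltnS le_mu /=; apply/esym/negbTE/existsP=> -[Y /andP[_ jY]].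
  by have := leq_trans jY (rho_le Y); rewrite leqNgt ltNj.
rewrite bigmin_leq [n < mu]ltnNge le_mu /=; apply/existsP/existsP.
  case=> Y /andP[/eqP <- Ymu].
  have [|Z sYZ /eqP Zmu] := @exists_superset_card _ Y mu.
    by rewrite Ymu card_ord.
  exists Z; rewrite Zmu; apply: setU1_steps_mono sYZ => W i /rho_setU1.
  by case/andP.
case=> Y /andP[/eqP <- jY].
have [||Z sZY Zj] := @setU1_steps_ivt _ (rho C B X) Y j.
- by move=> W i /rho_setU1/andP[].
- by rewrite rho_set0.
by exists Z; rewrite Zj eqxx subset_leq_card.
Qed.

End DemiMatroid.

(** * The random model as a uniform distribution, and entropy by counting *)

Section Entropy.

Variables (A : finType) (n : nat) (C : {set {ffun 'I_n -> A}}) (B : {set 'I_n}).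
Variable phi : A -> A -> A.

Hypothesis A_gt1 : 1 < #|A|.
Hypothesis phi_injl : forall y : A, injective (fun x => phi x y).

Lemma Phi_inj m : injective (@Phi A n phi m).
Proof.
move=> w v /ffunP eq_wv; apply/ffunP=> i; have := eq_wv i; rewrite !ffunE.
by case: (m i) => // a /phi_injl.
Qed.

Definition model_support : {set Omega A n} :=
  [set om : Omega A n | (om.1 \in msgs A B) && (om.2 \in Cm C phi om.1)].

Lemma model_supportE :
  model_support = [set (mw.1, Phi phi mw.1 mw.2) | mw in setX (msgs A B) C].
Proof.
apply/setP=> -[m v]; rewrite inE /=; apply/andP/imsetP.
  by case=> Mm /imsetP[w Cw ->]; exists (m, w); rewrite // inE Mm.
by case=> -[m' w]; rewrite inE /= => /andP[Mm Cw] [-> ->]; rewrite Mm imset_f.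
Qed.

(** Outcomes correspond bijectively to pairs of a message and an unmasked codeword; the count is
    arranged by codeword. *)
Lemma card_model_support_sub (P : pred (Omega A n)) :
  #|[set om in model_support | P om]| =
  \sum_(w in C) #|[set m in msgs A B | P (m, Phi phi m w)]|.
Proof.
rewrite -sum1_card; under eq_bigl do rewrite inE model_supportE.
rewrite big_mkcondr big_imset /=; last first.
  by move=> [m w] [m' w'] _ _ /= [<-] /Phi_inj ->.
rewrite (eq_bigl (fun p => (p.1 \in msgs A B) && (p.2 \in C))); last first.
  by case=> m w; rewrite inE.
rewrite -(pair_big (mem (msgs A B)) (mem C)
  (fun m w => if P (m, Phi phi m w) then 1 else 0)) exchange_big /=.
apply: eq_bigr => w _.
rewrite -sum1_card [RHS](eq_bigl (fun m => (m \in msgs A B) && P (m, Phi phi m w))).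
  by rewrite big_mkcondr.
by move=> m; rewrite inE.
Qed.

Lemma card_model_support : #|model_support| = #|msgs A B| * #|C|.
Proof.
rewrite model_supportE card_in_imset ?cardsX // => -[m w] [m' w'] _ _ /= [<-].
by move/Phi_inj->.
Qed.

(** Masking is injective, so every [Cm] has [#|C|] elements and all outcomes in the support are
    equally likely. *)
Lemma PrE (T : finType) (f : Omega A n -> T) (v : T) :
  Pr C B phi f v =
  Rdiv (INR #|[set om in model_support | f om == v]|) (INR #|model_support|).
Proof.
rewrite /Pr -sum1_card (big_morph INR plus_INR (erefl _)) /Rdiv big_distrl /=.
rewrite [RHS](eq_bigl (fun om => (f om == v) && (om \in model_support))); last first.
  by move=> om; rewrite inE andbC.
rewrite [RHS]big_mkcondr; apply: eq_bigr => om _; rewrite /Pmodel /model_support inE.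
case: ifP => // _; rewrite Rmult_1_l card_model_support mult_INR /Cm card_imset //.
exact: Phi_inj.
Qed.

Lemma logA_expn e : logA A (INR (#|A| ^ e)) = INR e.
Proof.
have lnA : ln (INR #|A|) <> R0.
  apply/Rgt_not_eq/Rlt_gt; rewrite -[R0]/(IZR 0) -ln_1.
  by apply: ln_increasing; [exact: Rlt_0_1 | apply/(lt_INR 1)/ltP].
have -> : INR (#|A| ^ e) = pow (INR #|A|) e.
  by elim: e => //= e <-; rewrite expnS mult_INR.
rewrite /logA ln_pow; last by apply/lt_0_INR/ltP/ltnW.
by field.
Qed.

(* The counting hypothesis says that [P(f = a | g = b)] is [#|A| ^ - e] whenever
   it is nonzero. *)
Lemma condH_const (T1 T2 : finType) (f : Omega A n -> T1) (g : Omega A n -> T2)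
    (e : nat) :
  model_support != set0 ->
  (forall om, om \in model_support ->
     #|[set om' in model_support | g om' == g om]| =
     #|A| ^ e * #|[set om' in model_support | (f om', g om') == (f om, g om)]|) ->
  condH C B phi f g = INR e.
Proof.
move=> supp0 count; rewrite /condH.
have S0 : INR #|model_support| <> R0.
  by apply: not_0_INR; apply/eqP; rewrite cards_eq0.
(* Summands of probability zero fit the same formula, so the factor [INR e] comes out of the sum. *)
transitivity (\big[Rplus/R0]_(a : T1) \big[Rplus/R0]_(b : T2)
   Rmult (Pr C B phi (fun om => (f om, g om)) (a, b)) (INR e)).
  apply: eq_bigr => a _; apply: eq_bigr => b _ /=.
  case: (Req_dec_T _ _) => [p0|] /=; first by rewrite p0 Rmult_0_l.
  rewrite !PrE => nz; congr Rmult.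
  have /set0Pn[om] : [set om in model_support | (f om, g om) == (a, b)] != set0.
    apply/eqP=> E; apply: nz; rewrite E cards0 /=; exact: Rdiv_0_l.
  rewrite inE => /andP[Som /eqP Eom]; move: nz; rewrite -Eom.
  case: Eom => _ <-; rewrite count // mult_INR => nz.
  rewrite -[RHS]logA_expn; congr logA.
  have cancel x y z : Rdiv y z <> R0 -> z <> R0 ->
      Rdiv (Rdiv (Rmult x y) z) (Rdiv y z) = x.
    move=> yz_neq0 z_neq0; field; split=> // y0.
    by apply: yz_neq0; rewrite y0; exact: Rdiv_0_l.
  exact: cancel.
under eq_bigr do rewrite -big_distrl /=.
rewrite -big_distrl pair_big /= -[RHS]Rmult_1_l; congr Rmult.
(* The remaining factor is the total mass, computed as the law of a constant map. *)
rewrite -[RHS]/R1; have -> : R1 = \big[Rplus/R0]_(om : Omega A n) Pmodel C B phi om.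
  have := PrE (fun=> tt) tt; rewrite /Pr.
  under eq_bigl do rewrite eqxx.
  move=> ->; rewrite (_ : [set om in _ | _] = model_support).
    by rewrite /Rdiv Rinv_r.
  by apply/setP=> om; rewrite inE eqxx andbT.
rewrite [RHS](partition_big (fun om => (f om, g om)) predT) //=.
Qed.

End Entropy.

(** * The entropy of the message given the observation *)

Section MessageEntropy.

Variables (A : finType) (n k : nat) (C : {set {ffun 'I_n -> A}}).
Variables (B X : {set 'I_n}) (phi : A -> A -> A).
Implicit Types (Y : {set 'I_n}) (w : {ffun 'I_n -> A}) (m : {ffun 'I_n -> option A}).

Hypothesis A_gt1 : 1 < #|A|.
Hypothesis C_aa : almost_affine k C.
Hypothesis phi_bijr : forall y : A, bijective (phi y).
Hypothesis phi_injl : forall y : A, injective (fun x => phi x y).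

(** The conditions on the message are coordinatewise, so the admissible messages form a product of
    the sets [F i] and the count is the product of their sizes. *)
Lemma card_messages_through Y m0 w0 w : m0 \in msgs A B ->
  #|[set m in msgs A B | (proj Y (Phi phi m w), proj X m)
                      == (proj Y (Phi phi m0 w0), proj X m0)]| =
  if proj (Y :&: (B :|: X)) w == proj (Y :&: (B :|: X)) w0
  then #|A| ^ #|~: (B :|: X :|: Y)| else 0.
Proof.
rewrite inE => /forallP m0P.
pose mask (o : option A) x := if o is Some a then phi x a else x.
pose F i : pred (option A) := [pred o | [&& (o == None) == (i \in B),
  (i \in X) ==> (o == m0 i) & (i \in Y) ==> (mask o (w i) == mask (m0 i) (w0 i))]].
have -> : #|[set m in msgs A B | (proj Y (Phi phi m w), proj X m)
                      == (proj Y (Phi phi m0 w0), proj X m0)]| = #|family F|.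
  apply: eq_card => m; rewrite !inE xpair_eqE.
  apply/andP/familyP => [[/forallP mP /andP[/proj_eqP mY /proj_eqP mX]] i|mF].
    rewrite !inE mP /=; apply/andP; split; apply/implyP=> iS; first by rewrite mX.
    by apply/eqP; have := mY i iS; rewrite !ffunE.
  split; first by apply/forallP=> i; case/and3P: (mF i).
  apply/andP; split; apply/proj_eqP=> i iS; case/and3P: (mF i) => _.
    by move=> _ /implyP/(_ iS)/eqP; rewrite !ffunE.
  by move=> /implyP/(_ iS)/eqP.
rewrite card_family foldrE big_map big_enum /=.
(* On [B :|: X] the entry must be that of [m0]; on [Y] it then reproduces the observed symbol only
   if the codewords agree at [i]. *)
have FZ i : i \in B :|: X -> #|F i| = ((i \in Y) ==> (w i == w0 i)).
  move=> iZ; have [wi|wi] := boolP (_ ==> _).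
    apply: (@eq_card1 _ (m0 i)) => o; rewrite !inE.
    apply/idP/eqP => [/and3P[]|->]; last first.
      rewrite m0P eqxx implybT /=; apply/implyP=> iY.
      by move/implyP: wi => /(_ iY)/eqP->.
    move: iZ; rewrite inE => /orP[iB|->] /=; last by move=> _ /eqP.
    by move: (m0P i); rewrite iB eqb_id => /eqP-> /eqP/eqP.
  apply: eq_card0 => o; apply/negP=> /and3P[oB oX /implyP oY].
  move: wi; rewrite negb_imply => /andP[/oY + /negP[]].
  have -> : o = m0 i.
    move: iZ; rewrite inE => /orP[iB|iX]; last exact/eqP/(implyP oX).
    by move: oB (m0P i); rewrite iB !eqb_id => /eqP-> /eqP->.
  by rewrite /mask; case: (m0 i) => [a|//] /eqP/phi_injl->.
(* Elsewhere, an observed symbol fixes the entry by bijectivity of [phi (w i)]; without observation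
   every value except [None] is allowed. *)
have FnZ i : i \notin B :|: X -> #|F i| = if i \in Y then 1 else #|A|.
  rewrite inE negb_or => /andP[/negPf iB /negPf iX]; case: ifP => iY.
    have [g gK Kg] := phi_bijr (w i).
    apply: (@eq_card1 _ (Some (g (mask (m0 i) (w0 i))))) => o.
    rewrite !inE iB iX iY /=.
    case: o => [a|] //=; by apply/eqP/eqP => [<-|[->]]; rewrite ?gK ?Kg.
  rewrite -[RHS](_ : #|predC1 (None : option A)| = _).
    by apply: eq_card => o; rewrite !inE iB iX iY /= !andbT eqbF_neg.
  by rewrite cardC1 card_option.
case: ifP => [/proj_eqP agree|/proj_eqP disagree].
  rewrite -prod_nat_const big_mkcond /= [RHS]big_mkcond; apply: eq_bigr => i _.
  have [iZ|iZ] := boolP (i \in B :|: X).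
    rewrite FZ // in_setC in_setU iZ /=.
    by case: (boolP (i \in Y)) => //= iY; rewrite agree ?eqxx // inE iY.
  by rewrite FnZ // in_setC in_setU (negPf iZ) /=; case: ifP.
have /forall_inPn[i] : ~~ [forall i in Y :&: (B :|: X), w i == w0 i].
  by apply/negP=> /forall_inP agree; apply: disagree => i /agree/eqP.
rewrite inE => /andP[iY iZ] wi; rewrite (bigD1 i) //= FZ // iY.
by rewrite (negPf wi) mul0n.
Qed.

Hypothesis B_basis : is_basis C B.
Hypothesis XB : X \subset ~: B.

(** An observation is compatible with a fibre over [Y :&: (B :|: X)] of codewords, each with a power
    of [#|A|] of messages. Fixing the message as well leaves a fibre over [Y], and the ratio of the
    two counts gives the entropy. *)
Lemma Hm_rho Y : Hm C B phi X Y = INR (n - #|X| - k - rho C B X Y).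
Proof.
apply: condH_const => //.
  rewrite -card_gt0 card_model_support // muln_gt0 C_aa.1 expn_gt0 (ltnW A_gt1) andbT.
  case/card_gt0P: (ltnW A_gt1) => a _; apply/card_gt0P.
  exists [ffun i => if i \in B then None else Some a].
  by rewrite inE; apply/forallP=> i; rewrite ffunE; case: ifP.
move=> om; rewrite {1}model_supportE => /imsetP[[m0 w0] /setXP[Mm0 Cw0] ->] /=.
rewrite !card_model_support_sub //=.
under eq_bigr do rewrite card_messages_through //.
rewrite -big_mkcondr sum_nat_const /=.
have -> : #|[pred w in C | proj (Y :&: (B :|: X)) w == proj (Y :&: (B :|: X)) w0]|
        = #|fiber C (Y :&: (B :|: X)) w0|.
  by apply: eq_card => w; rewrite !inE.
have -> : \sum_(w in C) #|[set m in msgs A B |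
    (m, (proj Y (Phi phi m w), proj X m)) == (m0, (proj Y (Phi phi m0 w0), proj X m0))]|
  = #|fiber C Y w0|.
  rewrite -sum1_card [RHS](eq_bigl (fun w => (w \in C) && (proj Y w == proj Y w0))).
    rewrite [RHS]big_mkcondr; apply: eq_bigr => w Cw.
    (* With the message fixed, masking is injective at each coordinate, so agreement on [Y] is
       unaffected by it. *)
    have masked :
        (proj Y (Phi phi m0 w) == proj Y (Phi phi m0 w0)) = (proj Y w == proj Y w0).
      apply/proj_eqP/proj_eqP => eqY i iY;
        have := eqY i iY; rewrite !ffunE; last by move->.
      by case: (m0 i) => // a /phi_injl.
    case: ifP => [wY|wY].
      apply/eqP/cards1P; exists m0; apply/setP=> m; rewrite inE in_set1 !xpair_eqE.
      by case: eqVneq => [->|_]; rewrite ?andbF // masked wY eqxx Mm0.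
    apply/eqP; rewrite cards_eq0; apply/eqP/setP=> m; rewrite inE in_set0 !xpair_eqE.
    by case: eqVneq => [->|_]; rewrite ?andbF // masked wY !andbF.
  by move=> w; rewrite inE.
rewrite !(card_fiber A_gt1 C_aa) // -!expnD; congr (_ ^ _).
(* These bounds make every truncated subtraction in the exponents exact. *)
have := rho_le A_gt1 C_aa B_basis XB Y; have := rk_le_rD B X A_gt1 C_aa Y.
have := rk_le A_gt1 C_aa Y; have := rk_le A_gt1 C_aa (Y :&: (B :|: X)).
have := cardsC (B :|: X :|: Y); have := card_basisU A_gt1 C_aa B_basis XB.
have := cardsUI (Y :\: (B :|: X)) (B :|: X).
rewrite card_ord (_ : (Y :\: (B :|: X)) :&: (B :|: X) = set0) ?cards0; last first.
  by apply/setP=> i; rewrite !inE; do !case: (i \in _).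
rewrite (_ : Y :\: (B :|: X) :|: (B :|: X) = B :|: X :|: Y); last first.
  by apply/setP=> i; rewrite !inE; do !case: (i \in _).
rewrite /rho /rD.
move: #|B :|: X :|: Y| #|~: (B :|: X :|: Y)| #|B :|: X| #|Y :\: (B :|: X)| #|X|.
by move: (rk C Y) (rk C (Y :&: (B :|: X))); lia.
Qed.

(** Moves the minimum from the reals to the natural numbers, as [INR] commutes with minima; the
    order description of [E] suffices afterwards. *)
Lemma Emin_INR_leq mu : mu <= n ->
  exists E : nat, Emin C B phi X mu = INR E /\
  forall e, (E <= e) =
    [exists Y : {set 'I_n}, (#|Y| == mu) && (n - #|X| - k - rho C B X Y <= e)].
Proof.
move=> le_mu; pose F Y := n - #|X| - k - rho C B X Y.
pose Y0 := [set i : 'I_n | i < mu].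
exists (\big[minn/F Y0]_(Y : {set 'I_n} | #|Y| == mu) F Y); split.
  rewrite (big_morph INR (op1 := Rmin) (id1 := INR (F Y0)) _ (erefl _)).
    by rewrite /Emin Hm_rho; apply: eq_bigr => Y _; rewrite Hm_rho.
  move=> a b /=; rewrite /minn; case: ltnP => ab.
    by rewrite Rmin_left //; apply/le_INR/leP/ltnW.
  by rewrite Rmin_right //; apply/le_INR/leP.
(* The default comes from [Y0], which has size [mu] because [mu <= n], so it adds no new
   candidate. *)
move=> e'; rewrite bigmin_leq; apply/orb_idl => FY0.
apply/existsP; exists Y0; rewrite FY0 andbT.
rewrite -sum1_card; under eq_bigl do rewrite inE.
by rewrite -(big_ord_widen n (fun=> 1) le_mu) sum1_card card_ord.
Qed.

End MessageEntropy.

(** * Comparing the largest [rho] at size [mu] with the thresholds *)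

Theorem mainTheorem11 (A : finType) (n k : nat) (C : {set {ffun 'I_n -> A}})
  (B : {set 'I_n}) (phi : A -> A -> A) (X : {set 'I_n}) (j mu : nat) :
  1 < #|A| ->
  almost_affine k C ->
  is_basis C B ->
  (forall y : A, bijective (phi y)) ->
  (forall y : A, bijective (fun x => phi x y)) ->
  X \subset ~: B ->
  mu <= n ->
  j <= n - #|X| - k ->
  (Delta_mu k C B phi X mu = INR (#|X| + j) <->
   sigma_j k C B X j <= mu < sigma_j k C B X j.+1).
Proof.
move=> A_gt1 C_aa B_basis phi_bijr phi_bijl XB le_mu le_j.
have phi_injl y := bij_inj (phi_bijl y).
have [E [EminE E_leq]] := Emin_INR_leq A_gt1 C_aa phi_bijr phi_injl B_basis XB le_mu.
rewrite [mu < _]ltnNge !(sigma_leq A_gt1 C_aa B_basis XB) //.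
pose N := n - #|X| - k.
have nE : n = (#|X| + k + N)%N.
  have := cardsC (B :|: X); rewrite card_ord (card_basisU A_gt1 C_aa B_basis XB).
  by rewrite /N; lia.
(* [E] is [N] minus the largest [rho] at size [mu]; [i <= N] keeps [N - i] exact. *)
have max_le i : i <= N ->
  [exists Y : {set 'I_n}, (#|Y| == mu) && (i <= rho C B X Y)] = (E <= N - i).
  move=> iN; rewrite E_leq; apply: eq_existsb => Y; congr andb.
  by have := rho_le A_gt1 C_aa B_basis XB Y; rewrite -/N; lia.
have -> : Delta_mu k C B phi X mu = Rminus (INR (#|X| + N)) (INR E).
  rewrite /Delta_mu EminE {1}nE !plus_INR; ring.
have -> : (Rminus (INR (#|X| + N)) (INR E) = INR (#|X| + j)) <-> E = N - j.
  split=> [eqR|->].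
    suff : (#|X| + N = #|X| + j + E)%N by lia.
    by apply: INR_eq; rewrite [RHS]plus_INR -eqR; ring.
  by rewrite -minus_INR; [congr INR; lia | lia].
rewrite max_le //; have [ltj|] := ltnP j N; last first.
  (* At [j = N] the next threshold is infinite: no [rho] exceeds [N], so only the lower inequality
     remains. *)
  move=> leNj; have -> : j = N by lia.
  rewrite (_ : [exists Y, _] = false) ?andbT.
    by rewrite subnn leqn0; split=> [->|/eqP].
  apply/negbTE/existsP=> -[Y /andP[_]].
  by have := rho_le A_gt1 C_aa B_basis XB Y; rewrite -/N; lia.
by rewrite max_le //; split; lia.
Qed.
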